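(* Suppose that the Dense Sidon Set Conjecture (stated in the context) holds. Then there are constants $\varepsilon > 0$ and $n_0$ such that the following is true. Suppose $S$ is a Sidon set in an abelian group $G$ of order $n \geq n_0$, and suppose $|S| > (1-\varepsilon) n^{1/2}$. Then \[ |G| \in \{ q^2+q+1,\ q^2,\ q^2-1,\ q^2-q^{1/2},\ q(q-1),\ (q-1)^2 \} \] for some integer $q > 1$. In particular (still assuming the conjecture), \[ \liminf_{n \to \infty} \frac{\max \{ |S| : S \subseteq \mathbf{Z}/n\mathbf{Z} \text{ is a Sidon set} \}}{n^{1/2}} < 1. \]
   Context: A subset $S$ of an abelian group $G$ is a Sidon set if for all $x,y,z,w \in S$, $x+y=z+w$ implies $\{x,y\}=\{z,w\}$. A Sidon set $S$ in an abelian group of order $n$ is called dense if $|S| \ge (1-o(1)) n^{1/2}$ (as $n \to \infty$). An incidence structure $(P, L, I)$ is a triple of sets with $I \subset P \times L$; elements of $P$ are points, elements of $L$ are lines, and $p \in \ell$ means $(p,\ell)\in I$. A projective plane is an incidence structure in which any two distinct points are incident with exactly one common line and any two distinct lines with exactly one common point; projective planes here are finite and have an order, i.e. there is a positive integer $q$ such that there are $q^2+q+1$ points and $q^2+q+1$ lines, every line contains $q+1$ points and every point lies on $q+1$ lines (so degenerate planes are excluded). Its size $|\mathcal{P}|$ is the number of points. A group acts on $\mathcal{P}$ by automorphisms of the incidence structure; $p^g$ denotes the image of $p$ under $g$. Dense Sidon Set Conjecture: Suppose $S$ is a dense Sidon set in an abelian group $G$ of order $n$. Then $G$ acts faithfully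 on a projective plane $\mathcal{P}$ of size $|\mathcal{P}| = (1+o(1)) n$ in such a way that for some point $p$ and line $\ell$, $S \subset \{g \in G : p^g \in \ell\}$. Precisely: for every $\delta > 0$ there are $\eta > 0$ and $N$ such that whenever $G$ is an abelian group of order $n \ge N$ and $S \subset G$ is a Sidon set with $|S| \ge (1-\eta) n^{1/2}$, there exist a projective plane $\mathcal{P}$ with $\bigl| |\mathcal{P}| - n \bigr| \le \delta n$, a faithful action of $G$ on $\mathcal{P}$ by automorphisms, a point $p$ and a line $\ell$ with $S \subset \{g \in G : p^g \in \ell\}$. *)

(* Defs.v *)
From mathcomp Require Import all_boot all_order all_algebra all_fingroup.
From mathcomp Require Import all_classical all_reals all_analysis.

Set Implicit Arguments.
Unset Strict Implicit.
Unset Printing Implicit Defensive.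

Import Order.TTheory GRing.Theory Num.Theory.

(* The group law is written multiplicatively, as for every finGroupType; on
   'Z_n it is addition. *)
Definition sidon (gT : finGroupType) (S : {set gT}) : bool :=
  [forall x in S, forall y in S, forall z in S, forall w in S,
    ((x * y)%g == (z * w)%g) ==> ([set x; y]%SET == [set z; w]%SET)].

Record incidence_structure := IncidenceStructure {
  point : finType;
  line : finType;
  incident : point -> line -> bool
}.

Definition has_order (X : incidence_structure) (q : nat) : Prop :=
  [/\ #|point X| = (q ^ 2 + q + 1)%N,
      #|line X| = (q ^ 2 + q + 1)%N,
      forall l : line X, #|[set p : point X | incident p l]%SET| = q.+1
    & forall p : point X, #|[set l : line X | incident p l]%SET| = q.+1].

Definition projective_plane (X : incidence_structure) : Prop :=
  [/\ forall p1 p2 : point X, p1 != p2 ->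
        exists! l : line X, incident p1 l /\ incident p2 l,
      forall l1 l2 : line X, l1 != l2 ->
        exists! p : point X, incident p l1 /\ incident p l2
    & exists2 q : nat, (0 < q)%N & has_order X q].

(* An automorphism of an incidence structure moves both points and lines, so a
   group acting by automorphisms is given by a pair of actions. *)
Definition acts_by_automorphisms (gT : finGroupType) (G : {group gT})
    (X : incidence_structure)
    (toP : action G (point X)) (toL : action G (line X)) : Prop :=
  forall g, g \in G -> forall (p : point X) (l : line X),
    incident (toP p g) (toL l g) = incident p l.

Definition acts_faithfully (gT : finGroupType) (G : {group gT})
    (X : incidence_structure)
    (toP : action G (point X)) (toL : action G (line X)) : Prop :=
  forall g, g \in G -> (forall p : point X, toP p g = p) ->
    (forall l : line X, toL l g = l) -> g = 1%g.

Local Open Scope ring_scope.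

Definition dense_sidon_set_conjecture (R : realType) : Prop :=
  forall delta : R, 0 < delta ->
  exists (eta : R) (N : nat), 0 < eta /\
  forall (gT : finGroupType) (G : {group gT}) (S : {set gT}),
    abelian G -> (N <= #|G|)%N ->
    S \subset G -> sidon S ->
    (1 - eta) * Num.sqrt (#|G|%:R : R) <= #|S|%:R ->
  exists (X : incidence_structure)
         (toP : action G (point X)) (toL : action G (line X)),
    [/\ projective_plane X,
        `|#|point X|%:R - #|G|%:R| <= delta * #|G|%:R,
        acts_by_automorphisms toP toL,
        acts_faithfully toP toL
      & exists (p : point X) (l : line X),
          S \subset [set g in G | incident (toP p g) l]%SET].

(* Zp n is the additive group Z/nZ for every n >= 1, including n = 1, where it
   is a proper subgroup of the type 'Z_1. *)
Definition max_sidon_Zn (n : nat) : nat :=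
  (\max_(S : {set 'Z_n} | (S \subset Zp n) && sidon S) #|S|)%N.

(* Main.v *)
Require Import Defs.
From mathcomp Require Import all_boot all_order all_algebra all_fingroup.
From mathcomp Require Import zify.

Set Implicit Arguments.
Unset Strict Implicit.
Unset Printing Implicit Defensive.

(* The conjecture provides a projective plane of order q on which G acts with
   |G| close to q^2, so it suffices to find the possible orders of such a group
   (a weak form of the Dembowski-Piper theorem). A nontrivial collineation
   fixes at most 5q/4 points once q is large. As G is abelian, a point
   stabilizer fixes the whole orbit of the point; hence two irregular points in
   different, long orbits have stabilizers H, K with trivial intersection, and
   |H| |K| divides |G| and exceeds |G| / 2, so |H| |K| = |G|. Three such points
   force |H|^2 = |G|. This happens if there is no regular point orbit or,
   dually, no regular line orbit. Otherwise let l be a regular line with s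
   irregular points, of stabilizers H_i; these lie in different orbits.
   Counting the pairs (x, g) with x and x^g on l gives
     |G| + q = (q + 1 - s)^2 + sum_i |H_i|.
   For s >= 3 the order |G| is a square, and for s = 0, 1, 2 this equation
   leaves only the listed values. The exceptional family
   |G| = (q - q^(1/2) + 1)^2 of Dembowski and Piper consists of squares, so it
   need not be excluded.

   For the lower limit, n = k^2 + 2 is never a listed value. *)

Local Open Scope group_scope.
Local Open Scope nat_scope.

(** * Incidence counts and fixed points in a projective plane *)

Definition dual (X : incidence_structure) : incidence_structure :=
  IncidenceStructure (fun (l : line X) (p : point X) => incident p l).

Lemma projective_plane_dual (X : incidence_structure) :
  projective_plane X -> projective_plane (dual X).
Proof. by case=> uL uP [q q_gt0 [cP cL szL szP]]; split=> //; exists q. Qed.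

Lemma has_order_dual (X : incidence_structure) (q : nat) :
  has_order X q -> has_order (dual X) q.
Proof. by case. Qed.

Lemma joining_line_unique (X : incidence_structure) (p1 p2 : point X)
    (l1 l2 : line X) :
  projective_plane X -> p1 != p2 -> incident p1 l1 -> incident p2 l1 ->
  incident p1 l2 -> incident p2 l2 -> l1 = l2.
Proof.
case=> uL _ _ /uL[l [_ l_uniq]] p1l1 p2l1 p1l2 p2l2.
by rewrite -(l_uniq l1) // -(l_uniq l2).
Qed.

Lemma meeting_point_unique (X : incidence_structure) (l1 l2 : line X)
    (p1 p2 : point X) :
  projective_plane X -> l1 != l2 -> incident p1 l1 -> incident p1 l2 ->
  incident p2 l1 -> incident p2 l2 -> p1 = p2.
Proof.
by move=> /projective_plane_dual pX; apply: (joining_line_unique pX).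
Qed.

Lemma card_joining_line (X : incidence_structure) (p1 p2 : point X) :
  projective_plane X -> p1 != p2 ->
  #|[set l | incident p1 l && incident p2 l]| = 1%N.
Proof.
case=> uL _ _ /uL[l [[p1l p2l] l_uniq]].
apply/eqP/cards1P; exists l; apply/setP=> l'; rewrite !inE.
by apply/andP/eqP=> [[? ?]|->//]; apply/esym/l_uniq.
Qed.

(** Each point of [F] is joined to [x] by exactly one line, so the lines through [x] partition
    [F]. *)
Lemma sum_card_pencil (X : incidence_structure) (F : {set point X})
    (x : point X) :
  projective_plane X -> x \notin F ->
  (\sum_(l | incident x l) #|[set p in F | incident p l]| = #|F|)%N.
Proof.
move=> pX xF; rewrite -sum1_card.
under eq_bigr => l _ do rewrite -sum1_card.
under eq_bigr => l _ do under eq_bigl => p do rewrite inE.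
rewrite (exchange_big_dep (mem F)) /=; last by move=> l p _ /andP[].
apply: eq_bigr => p pF; rewrite sum1_card.
have xp : x != p by apply: contraNneq xF => ->.
rewrite -[RHS](card_joining_line pX xp); apply: eq_card => l.
by rewrite !inE unfold_in pF.
Qed.

(* A point moved by the collineation lies on at most one fixed line, and every
   other line through it carries at most one fixed point; if there are many
   fixed points, this makes too many lines rich in fixed points. *)
Lemma card_fixed_points (X : incidence_structure) (q : nat)
    (fP : point X -> point X) (fL : line X -> line X) :
  projective_plane X -> has_order X q -> 68 < q ->
  (forall p l, incident (fP p) (fL l) = incident p l) ->
  (exists x, fP x != x) ->
  4 * #|[set x | fP x == x]| <= 5 * q.
Proof.
move=> pX [cP cL szL szP] q_gt aut [x0 x0_moved].
set F := [set x | fP x == x].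
pose f l := #|[set p in F | incident p l]|.
have fixed_line p1 p2 l : p1 != p2 -> p1 \in F -> p2 \in F -> incident p1 l ->
    incident p2 l -> fL l = l.
  rewrite !inE => p12 /eqP fp1 /eqP fp2 p1l p2l.
  apply: (joining_line_unique pX p12) => //; first by rewrite -fp1 aut.
  by rewrite -fp2 aut.
have rich_line l : 1 < f l -> fL l = l.
  move=> /card_gt1P[p1 [p2 [+ + p12]]].
  by rewrite !inE => /andP[? ?] /andP[? ?]; apply: (fixed_line p1 p2); rewrite ?inE.
have line_le l x : x \notin F -> incident x l -> f l <= q.
  move=> xF xl; rewrite -ltnS -(szL l); apply: proper_card.
  apply/properP; split; first by apply/subsetP => p; rewrite !inE => /andP[].
  by exists x; rewrite !inE ?xl //; move: xF; rewrite inE => /negbTE->.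
have [//|big_F] := leqP (4 * #|F|) (5 * q).
have heavy x : x \notin F -> exists2 l, incident x l & #|F| <= f l + q.
  move=> xF; have sumF := sum_card_pencil pX xF; have szx := szP x.
  have [/existsP[l /andP[xl fl]]|] := boolP [exists l, incident x l && (1 < f l)].
    exists l => //; rewrite -sumF (bigD1 l) //= leq_add2l.
    have -> : q = (\sum_(l' | incident x l' && (l' != l)) 1)%N.
      apply: succn_inj; rewrite -szx -sum1_card.
      under eq_bigl do rewrite inE.
      by rewrite (bigD1 l) //= add1n.
    apply: leq_sum => l' /andP[xl' l'l]; rewrite -/(f l') leqNgt.
    apply: contra l'l => fl'; apply/eqP.
    have [fixl fixl'] := (rich_line _ fl, rich_line _ fl').
    apply: contraNeq xF => l'l; rewrite inE; apply/eqP.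
    apply: (meeting_point_unique pX l'l) => //; first by rewrite -fixl' aut.
    by rewrite -fixl aut.
  move=> /existsPn no_rich.
  have : #|F| <= q.+1.
    rewrite -szx -sumF -sum1_card.
    under [leqRHS]eq_bigl do rewrite inE.
    by apply: leq_sum => l xl; move: (no_rich l); rewrite xl -leqNgt.
  lia.
have x0F : x0 \notin F by rewrite inE.
have F_le : #|F| <= 2 * q.
  have [l xl fl] := heavy _ x0F; have := line_le _ _ x0F xl; lia.
pose M := [set l | (#|F| <= f l + q) && (f l <= q)].
(* At least q^2 - q + 1 points are moved, and each lies on a line of [M], which has only q + 1
   points. *)
have M_ge : q - 2 <= #|M|.
  have : #|~: F| <= #|M| * q.+1.
    rewrite mulnC -(mul1n #|~: F|).
    have -> : (q.+1 * #|M| = \sum_(l in M) #|[set p | incident p l]|)%N.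
      by rewrite (eq_bigr (fun=> q.+1)) // sum_nat_const mulnC.
    rewrite mul1n -sum1_card.
    under [leqRHS]eq_bigr do rewrite -sum1_card.
    under [leqRHS]eq_bigr do under eq_bigl do rewrite inE.
    rewrite (exchange_big_dep xpredT) //= big_mkcond leq_sum // => p _.
    case: ifP => //; rewrite inE => pF; have [l pl fl] := heavy _ pF.
    by rewrite (bigD1 l) ?inE ?fl ?(line_le _ p).
  have := cardsC F; rewrite cP; have [//|] := leqP (q - 2) #|M|.
  by rewrite expnS expn1; nia.
(* Lines of [M] through [p] share no other fixed point, and each carries at least |F| - q - 1 >= (q
   - 3) / 4 others, out of at most 2q. *)
have M_pencil p : p \in F -> #|[set l in M | incident p l]| <= 8.
  move=> pF; have pF' : p \notin F :\ p by rewrite !inE eqxx.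
  have := sum_card_pencil pX pF'.
  have : #|F :\ p| <= 2 * q by rewrite (leq_trans _ F_le) // subset_leq_card // subsetDl.
  move=> + sumF; rewrite -sumF => sum_le.
  have : #|[set l in M | incident p l]| * (#|F| - q - 1) <= 2 * q.
    apply: leq_trans sum_le.
    rewrite -sum_nat_const [leqRHS](bigID (mem M)) /=.
    rewrite -[leqLHS]addn0 leq_add //.
    under eq_bigl do rewrite inE andbC.
    apply: leq_sum => l /andP[pl]; rewrite inE => /andP[fl _].
    have := cardsD1 p [set p0 in F | incident p0 l].
    rewrite !inE pl andbT -/F (_ : (fP p == p) = true) ?add1n; last first.
      by move: pF; rewrite inE.
    have -> : [set p0 in F | incident p0 l] :\ p = [set p0 in F :\ p | incident p0 l].
      by apply/setP => z; rewrite !inE andbA.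
    by rewrite -/(f l); lia.
  nia.
(* Counting incidences between [M] and [F] gives (q - 2)(|F| - q) <= 8|F|; with 4|F| > 5q this
   forces q < 42. *)
have : #|M| * (#|F| - q) <= 8 * #|F|.
  apply: (@leq_trans (\sum_(l in M) f l)%N).
    by rewrite -sum_nat_const; apply: leq_sum => l; rewrite inE => /andP[? _]; lia.
  rewrite /f; under eq_bigr do rewrite -sum1_card.
  under eq_bigr do under eq_bigl do rewrite inE.
  rewrite (exchange_big_dep (mem F)) /=; last by move=> ? ? _ /andP[].
  rewrite mulnC -sum_nat_const; apply: leq_sum => p pF.
  apply: leq_trans (M_pencil _ pF); rewrite sum1_card subset_leq_card //.
  by apply/subsetP => l /andP[lM /andP[_ pl]]; rewrite inE lM pl.
nia.
Qed.

(** * Orbits and stabilizers of an abelian group *)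

Lemma in_astab1 (gT : finGroupType) (G : {group gT}) (T : finType)
    (to : action G T) (x : T) (g : gT) :
  (g \in 'C_G[x | to]) = (g \in G) && (to x g == x).
Proof.
by rewrite !inE sub1set !inE; case: (g \in G).
Qed.

(** As [g] commutes with every [a] in [G], it fixes [to x a] once it fixes [x]. *)
Lemma orbit_subset_fix (gT : finGroupType) (G : {group gT}) (T : finType)
    (to : action G T) (x : T) (g : gT) :
  abelian G -> g \in 'C_G[x | to] -> orbit to G x \subset 'Fix_to[g].
Proof.
move=> abG; rewrite in_astab1 => /andP[gG /eqP xg].
apply/subsetP => _ /imsetP[a aG ->]; apply/afix1P.
by rewrite -actMin // (centsP abG a) // actMin // xg.
Qed.

Lemma disjoint_orbit (gT : finGroupType) (G : {group gT}) (T : finType)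
    (to : action G T) (x y : T) :
  y \notin orbit to G x -> [disjoint orbit to G x & orbit to G y].
Proof.
move=> xy; apply/pred0P => z /=; apply: contraNF xy => /andP[xz yz].
have [/(orbit_in_eqP (subxx G)) <-] := (xz, yz).
by move=> /(orbit_in_eqP (subxx G)) ->; apply: orbit_refl.
Qed.

Lemma leq_card_orbit (gT : finGroupType) (G : {group gT}) (T : finType)
    (to : action G T) (q : nat) (x : T) :
  abelian G ->
  (forall g, g \in G -> g != 1%g -> 4 * #|'Fix_to[g]| <= 5 * q) ->
  'C_G[x | to] != 1%g -> 4 * #|orbit to G x| <= 5 * q.
Proof.
move=> abG fixB /trivgPn[g gC g1]; apply: leq_trans (fixB g _ g1).
  by rewrite leq_mul2l subset_leq_card // orbit_subset_fix.
by move: gC; rewrite in_astab1 => /andP[].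
Qed.

(* An element fixing two points fixes both orbits pointwise, so two large
   orbits have stabilizers with trivial intersection; their product is a
   subgroup of index less than 2. *)
Lemma card_stabilizers_large_orbits (gT : finGroupType) (G : {group gT})
    (T : finType) (to : action G T) (q : nat) (x y : T) :
  abelian G -> 25 * q ^ 2 < 32 * #|G| ->
  (forall g, g \in G -> g != 1%g -> 4 * #|'Fix_to[g]| <= 5 * q) ->
  'C_G[x | to] != 1%g -> 'C_G[y | to] != 1%g ->
  y \notin orbit to G x ->
  5 * q < 4 * (#|orbit to G x| + #|orbit to G y|) ->
  #|'C_G[x | to]| * #|'C_G[y | to]| = #|G|.
Proof.
move=> abG q_lt fixB Cx Cy xy big_orbits.
have ti : 'C_G[x | to] :&: 'C_G[y | to] = 1%g.
  apply/eqP/trivgPn => -[g /setIP[gx gy] g1].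
  have gG : g \in G by move: gx; rewrite in_astab1 => /andP[].
  have : orbit to G x :|: orbit to G y \subset 'Fix_to[g].
    by rewrite subUset !orbit_subset_fix.
  move=> /subset_leq_card; rewrite cardsU disjoint_setI0 ?disjoint_orbit //.
  rewrite cards0 subn0; have := fixB g gG g1; lia.
have [Ox Oy] := (leq_card_orbit abG fixB Cx, leq_card_orbit abG fixB Cy).
have sGG : G \subset G by [].
have [Nx Ny] := (card_orbit_in_stab to x sGG, card_orbit_in_stab to y sGG).
have : #|'C_G[x | to]| * #|'C_G[y | to]| %| #|G|.
  have cyx : 'C_G[y | to] \subset 'C('C_G[x | to]).
    exact: sub_abelian_cent2 abG (subsetIl _ _) (subsetIl _ _).
  by rewrite -TI_cardMg // -(cent_joinEr cyx) cardSg // join_subG !subsetIl.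
move=> /dvdnP[k Nk]; have N_gt0 := cardG_gt0 G.
move: #|'C_G[x | to]| #|'C_G[y | to]| #|orbit to G x| #|orbit to G y| Ox Oy Nx Ny
  Nk => h h' w w' Ox Oy Nx Ny Nk.
have k_gt0 : 0 < k.
  by rewrite lt0n; apply: contraTneq N_gt0 => k0; rewrite Nk k0.
have [k_gt1|k_le1] := ltnP 1 k; last first.
  by rewrite Nk; have -> : k = 1%N; rewrite ?mul1n; lia.
(* An index [k] of at least 2 is contradictory: 16|G|^2 <= 25q^2 hh' <= 25q^2 |G|/2 < 16|G|^2. *)
have le1 : 4 * #|G| <= 5 * q * h by rewrite -Nx; nia.
have le2 : 4 * #|G| <= 5 * q * h' by rewrite -Ny; nia.
have le3 : 2 * (h * h') <= #|G| by rewrite Nk leq_mul.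
have : 16 * (#|G| * #|G|) <= 25 * q ^ 2 * (h * h') by nia.
have : 25 * q ^ 2 * (2 * (h * h')) <= 25 * q ^ 2 * #|G| by rewrite leq_mul2l le3 orbT.
have : 25 * q ^ 2 * #|G| < 32 * #|G| * #|G| by rewrite ltn_pmul2r.
lia.
Qed.

(** Burnside's double count of the pairs (x, g) with x fixed by g. *)
Lemma sum_card_astab1 (gT : finGroupType) (G : {group gT}) (T : finType)
    (to : action G T) :
  \sum_x #|'C_G[x | to]| = \sum_(g in G) #|'Fix_to[g]|.
Proof.
under eq_bigr do rewrite -sum1_card.
under [RHS]eq_bigr do rewrite -sum1_card.
rewrite (exchange_big_dep (mem G)) /=; last by move=> x g _; rewrite in_astab1 => /andP[].
apply: eq_bigr => g gG; apply: eq_bigl => x.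
by rewrite in_astab1 gG; apply/eqP/afix1P.
Qed.

(* The points with short orbits have large stabilizers, and by the fixed-point
   bound there can only be few of them; so there are three long orbits. *)
Lemma square_of_no_regular_orbit (gT : finGroupType) (G : {group gT})
    (T : finType) (to : action G T) (q : nat) :
  abelian G -> 68 < q -> #|T| = q ^ 2 + q + 1 -> 10 * #|T| <= 11 * #|G| ->
  (forall g, g \in G -> g != 1%g -> 4 * #|'Fix_to[g]| <= 5 * q) ->
  (forall x, 'C_G[x | to] != 1%g) ->
  exists m, #|G| = m ^ 2.
Proof.
move=> abG q_gt cT cTG fixB irreg.
have N_gt0 := cardG_gt0 G.
have q_lt : 25 * q ^ 2 < 32 * #|G| by lia.
(* Half of the bound 5q/4, so that two disjoint big orbits are too large to be fixed together. *)
pose big x := 5 * q < 8 * #|orbit to G x|.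
have mul_big x y : big x -> big y -> y \notin orbit to G x ->
    #|'C_G[x | to]| * #|'C_G[y | to]| = #|G|.
  rewrite /big => bx b_y xy.
  by apply: card_stabilizers_large_orbits (fixB) _ _ _ _ => //; lia.
have [/existsP[x /existsP[y /existsP[z /and5P[bx b_y bz xy /andP[xz yz]]]]]|] :=
    boolP [exists x, exists y, exists z, [&& big x, big y, big z,
      y \notin orbit to G x, z \notin orbit to G x & z \notin orbit to G y]].
  exists #|'C_G[x | to]|; have := mul_big _ _ bx b_y xy.
  have := mul_big _ _ bx bz xz; have := mul_big _ _ b_y bz yz.
  by move: #|'C_G[x | to]| #|'C_G[y | to]| #|'C_G[z | to]| => a b c; nia.
move=> no_triple.
have orbit_le x : 4 * #|orbit to G x| <= 5 * q by apply: leq_card_orbit.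
(* Without three disjoint big orbits, the big points fill at most two orbits, each of length at most
   5q/4. *)
have [A A_big cA] : exists2 A : {set T},
    forall x, big x -> x \in A & 4 * #|A| <= 10 * q.
  have [x bx|none] := pickP big; last first.
    by exists set0 => [x|]; rewrite ?none // cards0.
  have [y /andP[b_y xy]|none] := pickP [pred y | big y && (y \notin orbit to G x)].
    exists (orbit to G x :|: orbit to G y) => [z bz|].
      rewrite inE; apply: contraNT no_triple => /norP[xz yz].
      apply/existsP; exists x; apply/existsP; exists y; apply/existsP; exists z.
      by rewrite bx b_y bz xy xz yz.
    have [+ _] := leq_card_setU (orbit to G x) (orbit to G y).
    by have := orbit_le x; have := orbit_le y; lia.
  exists (orbit to G x) => [z bz|]; last by have := orbit_le x; lia.
  by have /= := none z; rewrite bz => /negbFE.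
(* Outside [A] orbits have length at most 5q/8. To leading order in q, the sum of the stabilizer
   orders is thus at least (8/5) q|G|, while Burnside's count gives at most (5/4) q|G|. *)
have sum_ge : 8 * #|G| * (#|T| - #|A|) <= 5 * q * \sum_x #|'C_G[x | to]|.
  have <- : #|~: A| = #|T| - #|A| by rewrite cardsCs setCK.
  rewrite mulnC -sum_nat_const big_distrr /=.
  rewrite [leqRHS](bigID (mem (~: A))) /= -[leqLHS]addn0 leq_add //.
  apply: leq_sum => x; rewrite inE => xA.
  have : ~~ big x by apply: contra xA; apply: A_big.
  rewrite -leqNgt -(card_orbit_in_stab to x (subxx G)) => xsmall.
  by rewrite mulnA leq_mul2r xsmall orbT.
have sum_le : 4 * \sum_x #|'C_G[x | to]| <= 4 * #|T| + 5 * q * #|G|.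
  rewrite sum_card_astab1 (bigD1 1%g) //= mulnDr leq_add //.
    by rewrite leq_mul2l max_card.
  rewrite big_distrr /= mulnC -sum_nat_const [leqRHS](bigD1 1%g) //=.
  apply: leq_trans (leq_addl _ _).
  by apply: leq_sum => g /andP[]; apply: fixB.
exfalso; move: sum_ge sum_le; set s := \sum_x _.
have A_le := max_card (mem A); move: q_gt cT cTG cA A_le N_gt0.
move: #|T| #|G| #|A| s => v n a s q_gt cT cTG cA A_le n_gt0 sum_ge sum_le.
have le1 : 32 * n * (v - a) <= 20 * q * v + 25 * (q * q) * n by nia.
have le2 : 32 * (n * v) <= 32 * n * (v - a) + 80 * (n * q).
  have : n * (4 * a) <= n * (10 * q) by rewrite leq_mul2l cA orbT.
  by rewrite -{1}(subnK A_le) mulnDr; lia.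
have le3 : 20 * q * v <= 22 * (n * q).
  have : q * (10 * v) <= q * (11 * n) by rewrite leq_mul2l cTG orbT.
  lia.
have le4 : n * (q * q) <= n * v by rewrite leq_mul2l cT; lia.
have : 7 * (n * (q * q)) <= 102 * (n * q) by lia.
have : n * q * 15 <= n * (q * q) by rewrite -mulnA !leq_mul2l; lia.
have : 0 < n * q by rewrite muln_gt0 n_gt0; lia.
lia.
Qed.

(** * Solving the counting equation for one or two irregular points *)

(* The integers [h] and [w - 1] have product [q (q - 1)] and sum at most
   [2 q], so AM-GM leaves only the sums [2 q - 1] and [2 q]. *)
Lemma order_one_irregular_point (n q h w : nat) :
  1 < q -> n + q = q * q + h -> w * h = n -> h <= q.+1 ->
  w + n <= q ^ 2 + q + 1 ->
  [\/ n = q ^ 2, n + 1 = q ^ 2 | exists2 r, q = r ^ 2 & n + r = q ^ 2].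
Proof.
move=> q_gt1 n_eq wh h_le w_le.
have w_gt0 : 0 < w by case: (w) wh => // ?; nia.
case: w w_gt0 wh w_le => // u _ wh w_le.
have uh : u * h + q = q * q by nia.
have sum_le : u + h <= 2 * q by nia.
have [le2|] := leqP (u + h + 2) (2 * q).
  have [AGM _] := nat_AGM2 u h.
  have : (u + h) ^ 2 <= (2 * q - 2) ^ 2 by rewrite leq_sqr; lia.
  by rewrite !expnS expn0 muln1 in AGM *; nia.
move=> sum_gt; have [sum1|sum2] : u + h = 2 * q - 1 \/ u + h = 2 * q by lia.
  have [hq|hq] : h = q \/ h = q - 1 by nia.
    by constructor 1; rewrite expnS expn1; lia.
  by constructor 2; rewrite expnS expn1; lia.
(* For u + h = 2q the product h(2q - h) = q(q - 1) reads (q - h)^2 = q. The value h = q + 1 would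
   give q = 1. *)
constructor 3; exists (q - h).
  have [hq|hq] := leqP h q; last by nia.
  rewrite expnS expn1; nia.
have [hq|hq] := leqP h q; last by nia.
rewrite expnS expn1; nia.
Qed.

(** The equations give (h - 1)(h' - 1) = (q - 1)(q - 2); as both factors are at most q, they are q -
    1 and q - 2 in some order. *)
Lemma order_two_irregular_points (n q h h' : nat) :
  2 < q -> n + q = (q - 1) * (q - 1) + (h + h') -> h * h' = n ->
  h <= q.+1 -> h' <= q.+1 -> n + q = q ^ 2.
Proof.
move=> q_gt2 n_eq hh h_le h'_le.
have h_gt0 : 0 < h by case: (h) hh n_eq => // *; nia.
have h'_gt0 : 0 < h' by case: (h') hh n_eq => // *; nia.
case: h h_gt0 hh n_eq h_le => // a _; case: h' h'_gt0 h'_le => // b _.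
rewrite !ltnS => b_le hh n_eq a_le.
case: q q_gt2 b_le a_le n_eq => [|[|[|c]]] // _ b_le a_le n_eq.
have ab : a * b = c.+2 * c.+1 by nia.
have a_gt : c < a by nia.
have b_gt : c < b by nia.
have [a3|[a3|a3]] : a = c.+1 \/ a = c.+2 \/ a = c.+3 by lia.
- have b3 : b = c.+2 by apply/eqP; rewrite -(eqn_pmul2l (ltn0Sn c)) -a3 ab mulnC a3.
  rewrite expnS expn1; nia.
- have b3 : b = c.+1 by nia.
  rewrite expnS expn1; nia.
- by have : c.+3 * c.+1 <= a * b; [rewrite a3 leq_mul2l | rewrite ab; lia].
Qed.

(** * Counting on a regular line *)

Lemma order_of_regular_orbits (X : incidence_structure) (q : nat)
    (gT : finGroupType) (G : {group gT})
    (toP : action G (point X)) (toL : action G (line X))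
    (p0 : point X) (l : line X) :
  projective_plane X -> has_order X q -> 68 < q -> abelian G ->
  acts_by_automorphisms toP toL ->
  10 * (q ^ 2 + q + 1) <= 11 * #|G| ->
  (forall g, g \in G -> g != 1%g -> 4 * #|'Fix_toP[g]| <= 5 * q) ->
  'C_G[p0 | toP] = 1%g -> 'C_G[l | toL] = 1%g ->
  [\/ #|G| = q ^ 2 + q + 1, #|G| + 1 = q ^ 2, #|G| + q = q ^ 2
    | exists2 r, q = r ^ 2 & #|G| + r = q ^ 2] \/ exists m, #|G| = m ^ 2.
Proof.
move=> pX oX q_gt abG aut cG fixB Cp0 Cl.
have [cP _ szL szP] := oX.
have N_gt0 := cardG_gt0 G; have sGG := subxx G.
have q_lt : 25 * q ^ 2 < 32 * #|G| by lia.
set O := orbit toP G p0; set K := [set x | incident x l].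
have cK : #|K| = q.+1 by apply: szL.
have cO : #|O| = #|G|.
  by rewrite -(card_orbit_in_stab toP p0 sGG) Cp0 cards1 muln1.
(* A second regular orbit would require 2|G| points, but there are at most 11|G|/10. *)
have regular_in_O x : 'C_G[x | toP] = 1%g -> x \in O.
  move=> Cx; apply: contraTT isT => xO; rewrite /=.
  have := max_card (mem (O :|: orbit toP G x)).
  have [_] := leq_card_setU O (orbit toP G x).
  rewrite disjoint_orbit // => /eqP ->; rewrite cO cP.
  have := card_orbit_in_stab toP x sGG; rewrite Cx cards1 muln1 => ->.
  nia.
(* A nontrivial stabilizer element of [x] also fixes [toP x g]; were these two distinct points of
   [l], it would fix the regular line [l]. *)
have same_orbit x g : x \in K -> x \notin O -> g \in G -> toP x g \in K ->
    toP x g = x.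
  rewrite !inE => xl xO gG xgl; apply: contraNeq xO => xg_neq.
  apply: regular_in_O; apply/eqP/trivgPn => -[h].
  rewrite in_astab1 => /andP[hG /eqP xh]; apply/negP; rewrite negbK.
  have xgh : toP (toP x g) h = toP x g.
    by rewrite -actMin // (centsP abG g) // actMin // xh.
  suff : h \in 'C_G[l | toL] by rewrite Cl inE.
  rewrite in_astab1 hG; apply/eqP.
  apply: (joining_line_unique pX xg_neq) => //.
    by rewrite -xgh aut.
  by rewrite -xh aut.
(* Since [l] is regular, g |-> l^g embeds the stabilizer of [x] into the q + 1 lines through [x]. *)
have stab_le x : x \in K -> #|'C_G[x | toP]| <= q.+1.
  rewrite inE => xl; rewrite -(szP x) -(card_in_imset (f := toL l)); last first.
    move=> g h; rewrite !in_astab1 => /andP[gG _] /andP[hG _] lgh.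
    have : (g * h^-1)%g \in 'C_G[l | toL].
      by rewrite in_astab1 groupM ?groupV //= actMin ?groupV // lgh actKin.
    by rewrite Cl inE -eq_mulgV1 => /eqP.
  apply: subset_leq_card; apply/subsetP => _ /imsetP[g + ->].
  by rewrite in_astab1 inE => /andP[gG /eqP xg]; rewrite -xg aut.
(* The identity contributes q + 1 points, every other [g] only the common point of [l] and its image
   under g^-1. *)
have count_lines : \sum_(g in G) #|[set x in K | toP x g \in K]| = #|G| + q.
  rewrite (bigD1 1%g) //=.
  have -> : [set x in K | toP x 1%g \in K] = K.
    by apply/setP => x; rewrite !inE act1 andbb.
  rewrite cK (eq_bigr (fun=> 1)) => [|g /andP[gG g1]].
    rewrite sum1_card (cardsD1 1%g G) group1 add1n.
    have -> : #|[pred i in G | i != 1%g]| = #|G :\ 1%g|.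
      by apply: eq_card => g; rewrite !inE andbC.
    by rewrite addSn addnC -addSn.
  have lg_neq : l != toL l g^-1%g.
    apply: contraNneq g1 => lg.
    have : g^-1%g \in 'C_G[l | toL] by rewrite in_astab1 groupV gG -lg eqxx.
    by rewrite Cl inE invg_eq1.
  rewrite -(card_joining_line (projective_plane_dual pX) lg_neq).
  apply: eq_card => x; rewrite !inE /=; congr (_ && _).
  by rewrite -(aut g gG x) actKVin.
set k := #|K :&: O|; set I := K :\: O.
have kI : k + #|I| = q.+1 by rewrite -cK cardsID.
(* A point of [O] reaches each of the [k] points of [l] in [O] by exactly one [g]; an irregular
   point returns to [l] only under its stabilizer. *)
have count_points :
    \sum_(g in G) #|[set x in K | toP x g \in K]| =
    k * k + \sum_(x in I) #|'C_G[x | toP]|.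
  under eq_bigr do rewrite -sum1_card.
  under eq_bigr do under eq_bigl do rewrite inE.
  rewrite (exchange_big_dep (mem K)) /=; last by move=> ? ? _ /andP[].
  rewrite (big_setID O) /=; congr (_ + _).
    rewrite -sum_nat_const; apply: eq_bigr => x /setIP[xK xO].
    rewrite xK /= sum1_card /k -(card_in_imset (f := toP x)).
      apply: eq_card => y; apply/imsetP/setIP => [[g]|[yK yO]].
        rewrite inE => /andP[gG xgK] ->.
        split; first by move: xgK; rewrite inE.
        by rewrite /O -(orbit_in_eqP sGG xO) mem_orbit.
      have /imsetP[g gG yE] : y \in orbit toP G x.
        by rewrite (orbit_in_eqP sGG xO).
      by exists g => //; rewrite unfold_in gG -yE.
    have Cx : 'C_G[x | toP] = 1%g.
      apply/eqP; rewrite trivg_card1.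
      have := card_orbit_in_stab toP x sGG.
      by rewrite (orbit_in_eqP sGG xO) cO => /eqP; rewrite -[X in _ == X]muln1 eqn_pmul2l.
    move=> g h /andP[gG _] /andP[hG _] lgh.
    have : (g * h^-1)%g \in 'C_G[x | toP].
      by rewrite in_astab1 groupM ?groupV //= actMin ?groupV // lgh actKin.
    by rewrite Cx inE -eq_mulgV1 => /eqP.
  apply: eq_bigr => x /setDP[xK xO]; rewrite sum1_card.
  apply: eq_card => g; rewrite in_astab1 unfold_in /= xK.
  case: (boolP (g \in G)) => //= gG; apply/idP/eqP => [|->//].
  exact: same_orbit.
rewrite count_lines in count_points.
have orbits_mul x y : x \in I -> y \in I -> x != y ->
    #|'C_G[x | toP]| * #|'C_G[y | toP]| = #|G|.
  move=> /setDP[xK xO] /setDP[yK yO] xy.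
  have irregular z : z \notin O -> 'C_G[z | toP] != 1%g.
    by apply: contraNneq; apply: regular_in_O.
  apply: (card_stabilizers_large_orbits (q := q)) => //; rewrite ?irregular //.
    apply: contraNN xy => /imsetP[g gG yE].
    by rewrite yE (same_orbit x g) // -yE.
  (* Stabilizers of order at most q + 1 leave orbits of length at least |G|/(q + 1) > 5q/8. *)
  have := stab_le _ xK; have := stab_le _ yK.
  have := card_orbit_in_stab toP x sGG; have := card_orbit_in_stab toP y sGG.
  move: #|'C_G[x | toP]| #|'C_G[y | toP]| #|orbit toP G x| #|orbit toP G y|.
  move=> h h' w w' Ny Nx h'_le h_le.
  have : #|G| <= w' * q.+1 by rewrite -Ny leq_mul2l h'_le orbT.
  have : #|G| <= w * q.+1 by rewrite -Nx leq_mul2l h_le orbT.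
  nia.
have [I3|I_le2] := leqP 3 #|I|.
  have /card_gt2P[x [y [z [[xI yI zI] [xy yz zx]]]]] := I3.
  right; exists #|'C_G[x | toP]|.
  have := orbits_mul _ _ xI yI xy; have := orbits_mul _ _ yI zI yz.
  have := orbits_mul _ _ zI xI zx.
  move: #|'C_G[x | toP]| #|'C_G[y | toP]| #|'C_G[z | toP]| => a b c.
  nia.
case I2 : #|I| I_le2 => [|[|[|//]]] _.
- move: count_points; rewrite (cards0_eq I2) big_set0.
  left; constructor 1; nia.
- have /cards1P[x Ix] : #|I| == 1 by rewrite I2.
  have xI : x \in I by rewrite Ix set11.
  have /setDP[xK xO] := xI.
  move: count_points; rewrite Ix big_set1 => count_points.
  have w_le : #|orbit toP G x| + #|G| <= q ^ 2 + q + 1.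
    rewrite -cP -cO.
    have [_] := leq_card_setU (orbit toP G x) O.
    rewrite disjoint_sym disjoint_orbit // => /eqP <-; exact: max_card.
  have [] := @order_one_irregular_point #|G| q #|'C_G[x | toP]| #|orbit toP G x|.
  + lia.
  + have kq : k = q by lia.
    by rewrite count_points kq.
  + exact: (card_orbit_in_stab toP x sGG).
  + exact: (stab_le _ xK).
  + exact: w_le.
  + by right; exists q.
  + by left; constructor 2.
  + by left; constructor 4.
- have /cards2P[x [y [xy Ixy]]] : #|I| == 2 by rewrite I2.
  have [xI yI] : x \in I /\ y \in I by rewrite Ixy !inE !eqxx orbT.
  left; constructor 3.
  apply: (@order_two_irregular_points _ _ #|'C_G[x | toP]| #|'C_G[y | toP]|).
  + lia.
  + rewrite count_points Ixy big_setU1 ?inE //= big_set1.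
    have -> : q - 1 = k by lia.
    by [].
  + exact: orbits_mul.
  + by apply: stab_le; case/setDP: xI.
  + by apply: stab_le; case/setDP: yI.
Qed.

(** * Faithful abelian collineation groups *)

Lemma fixed_lines_of_fixed_points (X : incidence_structure)
    (fP : point X -> point X) (fL : line X -> line X) :
  projective_plane X -> (forall p l, incident (fP p) (fL l) = incident p l) ->
  (forall p, fP p = p) -> forall l, fL l = l.
Proof.
move=> pX aut fixP l; have [_ _ [q q_gt0 [_ _ szL _]]] := pX.
have /card_gt1P[p1 [p2 [+ + p12]]] : 1 < #|[set p | incident p l]|.
  by rewrite szL ltnS.
rewrite !inE => p1l p2l.
apply: (joining_line_unique pX p12) => //; first by rewrite -{1}[p1]fixP aut.
by rewrite -{1}[p2]fixP aut.
Qed.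

Lemma card_fix_collineation (X : incidence_structure) (q : nat)
    (gT : finGroupType) (G : {group gT})
    (toP : action G (point X)) (toL : action G (line X)) (g : gT) :
  projective_plane X -> has_order X q -> 68 < q ->
  acts_by_automorphisms toP toL -> acts_faithfully toP toL ->
  g \in G -> g != 1%g -> 4 * #|'Fix_toP[g]| <= 5 * q.
Proof.
move=> pX oX q_gt aut faithful gG g1.
have -> : 'Fix_toP[g] = [set x | toP x g == x].
  by apply/setP => x; rewrite [RHS]inE; apply/afix1P/eqP.
apply: (card_fixed_points (fL := toL^~ g) pX oX q_gt).
  by move=> p l; apply: aut.
apply/existsP; apply: contraNT g1 => /existsPn fixP.
have {}fixP p : toP p g = p by apply/eqP; rewrite -[_ == _]negbK fixP.
apply/eqP/faithful => //.
by apply: (fixed_lines_of_fixed_points (fP := toP^~ g)) => // p l; apply: aut.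
Qed.

Lemma order_of_abelian_collineation_group (X : incidence_structure) (q : nat)
    (gT : finGroupType) (G : {group gT})
    (toP : action G (point X)) (toL : action G (line X)) :
  projective_plane X -> has_order X q -> 68 < q -> abelian G ->
  acts_by_automorphisms toP toL -> acts_faithfully toP toL ->
  10 * (q ^ 2 + q + 1) <= 11 * #|G| ->
  [\/ #|G| = q ^ 2 + q + 1, #|G| + 1 = q ^ 2, #|G| + q = q ^ 2
    | exists2 r, q = r ^ 2 & #|G| + r = q ^ 2] \/ exists m, #|G| = m ^ 2.
Proof.
move=> pX oX q_gt abG aut faithful cG; have [cP cL _ _] := oX.
have fixP g : g \in G -> g != 1%g -> 4 * #|'Fix_toP[g]| <= 5 * q.
  by apply: card_fix_collineation pX oX _ aut _.
have fixL g : g \in G -> g != 1%g -> 4 * #|'Fix_toL[g]| <= 5 * q.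
  apply: (card_fix_collineation (X := dual X) (toP := toL) (toL := toP)) => //.
  - exact: projective_plane_dual.
  - exact: has_order_dual.
  - by move=> h hG l p; apply: aut.
  - by move=> h hG fL fP; apply: faithful.
have [/existsP[p /eqP Cp]|/existsPn no_p] :=
    boolP [exists p, 'C_G[p | toP] == 1%g]; last first.
  by right; apply: (square_of_no_regular_orbit abG q_gt) fixP no_p; rewrite cP.
have [/existsP[l /eqP Cl]|/existsPn no_l] :=
    boolP [exists l, 'C_G[l | toL] == 1%g]; last first.
  by right; apply: (square_of_no_regular_orbit abG q_gt) fixL no_l; rewrite cL.
exact: (order_of_regular_orbits pX oX q_gt abG aut cG fixP Cp Cl).
Qed.

(* Consequences of the conjecture: group orders and the lower limit *)
Local Close Scope group_scope.

From mathcomp Require Import all_classical all_reals all_analysis.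
From mathcomp Require Import lra.

Import Order.TTheory GRing.Theory Num.Theory.
Local Open Scope ring_scope.

Definition dembowski_piper_values (R : realType) (q : nat) : seq R :=
  [:: q%:R ^+ 2 + q%:R + 1; q%:R ^+ 2; q%:R ^+ 2 - 1;
      q%:R ^+ 2 - Num.sqrt q%:R; q%:R * (q%:R - 1); (q%:R - 1) ^+ 2].

Lemma dense_sidon_card (R : realType) (Hconj : dense_sidon_set_conjecture R) :
  exists (eps : R) (n0 : nat), 0 < eps /\
    forall (gT : finGroupType) (G : {group gT}) (S : {set gT}),
      abelian G -> (n0 <= #|G|)%N ->
      S \subset G -> sidon S ->
      (1 - eps) * Num.sqrt (#|G|%:R : R) < #|S|%:R ->
    exists2 q : nat, (1 < q)%N &
      (#|G|%:R : R) \in dembowski_piper_values R q.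
Proof.
(* The tolerance 1/10 gives 10(q^2 + q + 1) <= 11|G|, and |G| >= 100^2 then yields q^2 + q + 1 >=
   9000, hence q > 68. *)
have [|eta [N [eta_gt0 conj]]] := Hconj (10%:R^-1); first by rewrite invr_gt0.
exists eta, (maxn N (100 * 100)); split=> // gT G S abG.
rewrite geq_max => /andP[N_le G_ge] sSG sidonS /ltW S_ge.
have [X [toP [toL [pX cX aut faithful _]]]] := conj gT G S abG N_le sSG sidonS S_ge.
have [_ _ [q _ oX]] := pX; have [cP _ _ _] := oX.
move: cX; rewrite cP ler_norml => /andP[cX1 cX2].
have cG1 : (10 * (q ^ 2 + q + 1) <= 11 * #|G|)%N.
  by rewrite -(ler_nat R) !natrM; lra.
have cG2 : (9 * #|G| <= 10 * (q ^ 2 + q + 1))%N.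
  by rewrite -(ler_nat R) !natrM; lra.
have q_gt : (68 < q)%N.
  rewrite ltnNge; apply/negP => q_le.
  have : (q ^ 2 <= 68 * 68)%N by rewrite expnS expn1 leq_mul.
  lia.
have q_gt1 : (1 < q)%N by apply: leq_trans q_gt.
have natr_sub (a b c : nat) : (a + b = c)%N -> a%:R = c%:R - b%:R :> R.
  by move=> <-; rewrite natrD addrK.
have [[e|e|e|[r qr e]]|[m e]] :=
    order_of_abelian_collineation_group pX oX q_gt abG aut faithful cG1.
- by exists q; [exact: q_gt1 | rewrite !inE e !natrD natrX eqxx].
- by exists q; [exact: q_gt1 | rewrite !inE (natr_sub _ _ _ e) natrX eqxx !orbT].
- exists q; first exact: q_gt1.
  by rewrite !inE (natr_sub _ _ _ e) natrX mulrBr mulr1 -expr2 eqxx !orbT.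
- exists q; first exact: q_gt1.
  have sq : Num.sqrt q%:R = r%:R :> R by rewrite qr natrX sqrtr_sqr normr_nat.
  by rewrite /dembowski_piper_values sq !inE (natr_sub _ _ _ e) natrX eqxx !orbT.
(* A square order is listed with the witness [m], which need not be the order of the plane. *)
- exists m; last by rewrite !inE e natrX eqxx !orbT.
  by rewrite ltnNge; apply/negP => m_le; nia.
Qed.

(** The listed values are too small for q < k and too large for q > k + 1; q = k and q = k + 1 are
    checked directly. The case k = 2 fails, as 6 = 3 * 2. *)
Lemma sqr_add2_notin (R : realType) (k q : nat) : (2 < k)%N -> (1 < q)%N ->
  (k ^ 2 + 2)%:R \notin dembowski_piper_values R q.
Proof.
move=> k_gt q_gt; rewrite !inE natrD natrX !negb_or.
have s_ge0 : 0 <= Num.sqrt (q%:R : R) by apply: sqrtr_ge0.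
have s_sqr : Num.sqrt q%:R ^+ 2 = q%:R :> R by rewrite sqr_sqrtr.
move: s_ge0 s_sqr; set s := Num.sqrt _ => s_ge0 s_sqr.
have y_ge : (3 : R) <= k%:R by rewrite ler_nat.
have x_ge : (2 : R) <= q%:R by rewrite ler_nat.
have s_le : s <= q%:R by rewrite -s_sqr; nra.
have cases : [\/ q%:R + 1 <= k%:R :> R, q%:R = k%:R :> R,
    q%:R = k%:R + 1 :> R | k%:R + 2 <= q%:R :> R].
  have [q_lt|k_le] := ltnP q k; first by constructor 1; rewrite natr1 ler_nat.
  have [q_le|k_lt] := leqP q k.
    by constructor 2; congr _%:R; apply/eqP; rewrite eqn_leq q_le k_le.
  have [q_le|k_lt2] := leqP q k.+1; last first.
    by constructor 4; rewrite -natrD ler_nat addn2.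
  by constructor 3; rewrite natr1; congr _%:R; apply/eqP; rewrite eqn_leq q_le k_lt.
move: (k%:R : R) (q%:R : R) y_ge x_ge s_le s_sqr cases => y x y_ge x_ge s_le s_sqr cases.
apply/and5P; split; last (apply/andP; split).
all: apply/eqP => e; case: cases => ?; nra.
Qed.

Lemma max_sidon_Zn_attained (n : nat) :
  exists S : {set 'Z_n}, [/\ S \subset Zp n, sidon S & #|S| = max_sidon_Zn n].
Proof.
have [|S /andP[sS sidonS] cS] := @eq_bigmax_cond {set 'Z_n}
    [pred S : {set 'Z_n} | (S \subset Zp n) && sidon S] (fun S => #|S|).
  (* The empty set makes the family nonempty, so its maximum is attained. *)
  apply/card_gt0P; exists finset.set0; rewrite inE finset.sub0set.
  by apply/forall_inP => x; rewrite finset.in_set0.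
by exists S; split=> //; rewrite -cS.
Qed.

Theorem corollary5p5 (R : realType) (Hconj : dense_sidon_set_conjecture R) :
  (exists (eps : R) (n0 : nat), 0 < eps /\
    forall (gT : finGroupType) (G : {group gT}) (S : {set gT}),
      abelian G -> (n0 <= #|G|)%N ->
      S \subset G -> sidon S ->
      (1 - eps) * Num.sqrt (#|G|%:R : R) < #|S|%:R ->
    exists2 q : nat, (1 < q)%N &
      (#|G|%:R : R) \in
        [:: q%:R ^+ 2 + q%:R + 1; q%:R ^+ 2; q%:R ^+ 2 - 1;
            q%:R ^+ 2 - Num.sqrt q%:R; q%:R * (q%:R - 1); (q%:R - 1) ^+ 2]) /\
  (limn_einf (fun n : nat => ((max_sidon_Zn n)%:R / Num.sqrt n%:R : R)%:E)
     < 1%:E)%E.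
Proof.
have dense := dense_sidon_card Hconj; split; first exact: dense.
have [eps [n0 [eps_gt0 {}dense]]] := dense.
have ratio_le k : (2 < k)%N -> (n0 <= k ^ 2 + 2)%N ->
    (max_sidon_Zn (k ^ 2 + 2))%:R / Num.sqrt (k ^ 2 + 2)%:R <= 1 - eps :> R.
  move=> k_gt; set n := (k ^ 2 + 2)%N => n_ge.
  have n_gt0 : (0 < n)%N by rewrite /n addn2.
  rewrite ler_pdivrMr ?sqrtr_gt0 ?ltr0n // leNgt; apply/negP => big.
  have [S [sS sidonS cS]] := max_sidon_Zn_attained n.
  have [] := dense _ (Zp_group n) S; rewrite /= ?card_Zp ?cS //.
    exact: FinRing.zmod_abelian.
  by move=> q q_gt; apply/negP/sqr_add2_notin.
rewrite limn_einf_lim; apply: (@le_lt_trans _ _ (1 - eps)%:E); last first.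
  by rewrite lte_fin; lra.
apply: lime_le; first exact: is_cvg_einfs.
apply: nearW => n.
(* The index k^2 + 2 lies in the tail from [n] and is at least [n0], so each tail infimum is at most
   1 - eps. *)
pose k := (maxn 3 (maxn n n0)).
apply: (@le_trans _ _ ((max_sidon_Zn (k ^ 2 + 2))%:R / Num.sqrt (k ^ 2 + 2)%:R : R)%:E).
  apply: ereal_inf_lbound; exists (k ^ 2 + 2)%N => //=.
  rewrite /k; nia.
rewrite lee_fin; apply: ratio_le; rewrite /k; nia.
Qed.
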